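(* For any $m\in\mathbb{Z}$ and any integer $n>0$, $$\mathrm{Res}_y\,\frac{e^{my}}{(e^y-1)^n}=\binom{m-1}{n-1}.$$
   Context: $\mathrm{Res}_y\,g(y)$ denotes the coefficient of $y^{-1}$ in the formal Laurent series $g(y)$. For $r\in\mathbb{Z}$ and $s\geq 0$, $\binom{r}{s}=\frac{r(r-1)\cdots(r-s+1)}{s!}$ (so $r$ may be negative). *)

(* Defs.v *)
From HB Require Import structures.
From mathcomp Require Import all_boot all_order all_algebra.
From mathcomp Require Import mathcomp_extra boolp classical_sets functions.
From mathcomp Require Import cardinality fsbigop.
From mathcomp Require Import zify.

Set Implicit Arguments.
Unset Strict Implicit.
Unset Printing Implicit Defensive.
Import Order.TTheory GRing.Theory Num.Theory.
Local Open Scope ring_scope.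

Section LaurentType.
Variable K : fieldType.

Definition bounded_below (f : int -> K) : Prop :=
  exists a : int, forall k : int, k < a -> f k = 0.

(* [coefl g k] is the coefficient of y^k; only finitely many negative powers of
   y occur, so these are the elements of K((y)). *)
Record laurent := Laurent {
  coefl :> int -> K;
  coefl_bounded : bounded_below coefl }.

HB.instance Definition _ := gen_eqMixin laurent.
HB.instance Definition _ := gen_choiceMixin laurent.

Lemma laurentP (f g : laurent) : (forall k, f k = g k) -> f = g.
Proof.
case: f g => [f fb] [g gb] /= /funext efg; case: g / efg gb => gb.
by congr Laurent; exact: Prop_irrelevance.
Qed.

Lemma laurent0_subproof : bounded_below (fun=> 0).
Proof. by exists 0. Qed.
Definition laurent0 : laurent := Laurent laurent0_subproof.

Lemma laurent1_subproof : bounded_below (fun k => (k == 0)%:R).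
Proof. by exists 0 => k; case: eqP => // ->; rewrite ltxx. Qed.
Definition laurent1 : laurent := Laurent laurent1_subproof.

Lemma laurentN_subproof (f : laurent) : bounded_below (fun k => - f k).
Proof. by have [a fa] := coefl_bounded f; exists a => k /fa ->; rewrite oppr0. Qed.
Definition laurentN (f : laurent) : laurent := Laurent (laurentN_subproof f).

Lemma laurentD_subproof (f g : laurent) : bounded_below (fun k => f k + g k).
Proof.
have [[a fa] [b gb]] := (coefl_bounded f, coefl_bounded g).
by exists (Num.min a b) => k; rewrite lt_min => /andP[/fa -> /gb ->]; rewrite addr0.
Qed.
Definition laurentD (f g : laurent) : laurent := Laurent (laurentD_subproof f g).

Lemma laurentM_subproof (f g : laurent) :
  bounded_below (fun k => \sum_(i \in [set: int]) f i * g (k - i)).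
Proof.
have [[a fa] [b gb]] := (coefl_bounded f, coefl_bounded g).
exists (a + b) => k ltk; apply: fsbig1 => i _.
have [/fa -> | lai] := ltP i a; first by rewrite mul0r.
by rewrite gb ?mulr0 //; lia.
Qed.

(* The sum has finite support, so that the finitely supported sum
   [\sum_(i \in _)] is the actual Cauchy product. *)
Definition laurentM (f g : laurent) : laurent := Laurent (laurentM_subproof f g).

Definition conv (F G : nat -> K) (n : nat) : K :=
  \sum_(i < n.+1) F i * G (n - i)%N.

Lemma convE (F G : nat -> K) (N n : nat) : (n < N)%N ->
  conv F G n = ((\poly_(i < N) F i) * (\poly_(i < N) G i))`_n.
Proof.
move=> nN; rewrite coefM; apply: eq_bigr => i _; rewrite !coef_poly.
by rewrite !ifT //; have := ltn_ord i; lia.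
Qed.

Lemma convC F G n : conv F G n = conv G F n.
Proof. by rewrite !(@convE _ _ n.+1) // mulrC. Qed.

Lemma convA F G H n : conv F (conv G H) n = conv (conv F G) H n.
Proof.
pose P F := \poly_(i < n.+1) (F i : K).
transitivity ((P F * (P G * P H))`_n).
  rewrite coefM; apply: eq_bigr => i _; rewrite coef_poly ltn_ord.
  by rewrite (@convE _ _ n.+1) // ltnS leq_subr.
rewrite mulrA coefM; apply: eq_bigr => i _; rewrite coef_poly ltnS leq_subr.
by rewrite (@convE _ _ n.+1).
Qed.

Lemma laurentM_below (f g : laurent) a b :
  (forall k, k < a -> f k = 0) -> (forall k, k < b -> g k = 0) ->
  forall k, k < a + b -> laurentM f g k = 0.
Proof.
move=> fa gb k ltk; apply: fsbig1 => i _.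
have [/fa -> | lai] := ltP i a; first by rewrite mul0r.
by rewrite gb ?mulr0 //; lia.
Qed.

Lemma laurentME (f g : laurent) a b :
  (forall k, k < a -> f k = 0) -> (forall k, k < b -> g k = 0) ->
  forall n : nat, laurentM f g (a + b + n%:Z) =
    conv (fun i => f (a + i%:Z)) (fun i => g (b + i%:Z)) n.
Proof.
move=> fa gb n /=.
rewrite (fsbigE [seq a + i%:Z | i <- iota 0 n.+1]); first last.
- move=> i _ nin; have [/fa -> | lai] := ltP i a; first by rewrite mul0r.
  rewrite gb ?mulr0 //.
  have [//|le] := ltP (a + b + n%:Z - i) b; exfalso.
  case/mapP: nin; exists `|i - a|%N; last by lia.
  by rewrite mem_iota; lia.
- by [].
- by rewrite map_inj_uniq ?iota_uniq // => i j /addrI [].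
rewrite (eq_bigl xpredT) => [|i]; last by rewrite in_setT.
rewrite big_map -[iota 0 n.+1]/(index_iota 0 n.+1) big_mkord.
apply: eq_bigr => i _; congr (_ * g _); have := ltn_ord i; lia.
Qed.

Lemma eq_laurent_from (f g : laurent) a :
  (forall k, k < a -> f k = 0) -> (forall k, k < a -> g k = 0) ->
  (forall n : nat, f (a + n%:Z) = g (a + n%:Z)) -> f = g.
Proof.
move=> fa ga e; apply: laurentP => k.
have [lka | lak] := ltP k a; first by rewrite fa ?ga.
by have -> : k = a + `|k - a|%N%:Z by lia.
Qed.

Lemma laurentMC : commutative laurentM.
Proof.
move=> f g; have [[a fa] [b gb]] := (coefl_bounded f, coefl_bounded g).
apply: (@eq_laurent_from _ _ (a + b)) => [||n]; first exact: laurentM_below.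
  by move=> k; rewrite addrC; exact: laurentM_below.
by rewrite laurentME // [a + b]addrC laurentME // convC.
Qed.

Lemma laurentMA : associative laurentM.
Proof.
move=> f g h.
have [[a fa] [b gb] [c hc]] :=
  And3 (coefl_bounded f) (coefl_bounded g) (coefl_bounded h).
have fg := laurentM_below fa gb; have gh := laurentM_below gb hc.
apply: (@eq_laurent_from _ _ (a + (b + c))) => [||n].
- exact: laurentM_below.
- by rewrite addrA; exact: laurentM_below.
rewrite laurentME // [in RHS]addrA laurentME //.
have -> : (fun i => laurentM g h (b + c + i%:Z)) =
  conv (fun i => g (b + i%:Z)) (fun i => h (c + i%:Z)).
  by apply/funext => i; rewrite laurentME.
have -> : (fun i => laurentM f g (a + b + i%:Z)) =
  conv (fun i => f (a + i%:Z)) (fun i => g (b + i%:Z)).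
  by apply/funext => i; rewrite laurentME.
exact: convA.
Qed.

Lemma laurentM1l : left_id laurent1 laurentM.
Proof.
move=> f; have [a fa] := coefl_bounded f.
have o0 k : k < 0 -> laurent1 k = 0 by move=> /lt_eqF /= ->.
apply: (@eq_laurent_from _ _ a) => // [k|n].
  by rewrite -[a]add0r; exact: laurentM_below.
rewrite -[in LHS](add0r a) laurentME // /conv big_ord_recl /= subn0 mul1r.
by rewrite big1 ?addr0 // => i _; rewrite mul0r.
Qed.

Lemma laurentMDl : left_distributive laurentM laurentD.
Proof.
move=> f g h.
have [[a fa] [b gb] [c hc]] :=
  And3 (coefl_bounded f) (coefl_bounded g) (coefl_bounded h).
pose m := Num.min a b.
have fm k : k < m -> f k = 0 by rewrite lt_min => /andP[/fa].
have gm k : k < m -> g k = 0 by rewrite lt_min => /andP[_ /gb].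
have fgm k : k < m -> laurentD f g k = 0.
  by move=> km /=; rewrite fm ?gm ?addr0.
apply: (@eq_laurent_from _ _ (m + c)) => [||n]; first exact: laurentM_below.
  move=> k km; rewrite -[LHS]/(laurentM f h k + laurentM g h k).
  by rewrite !(laurentM_below _ hc km) // addr0.
rewrite laurentME //.
rewrite -[RHS]/(laurentM f h (m + c + n%:Z) + laurentM g h (m + c + n%:Z)).
rewrite !laurentME // /conv -big_split.
by apply: eq_bigr => i _; rewrite mulrDl.
Qed.

Lemma laurentDA : associative laurentD.
Proof. by move=> f g h; apply: laurentP => k /=; rewrite addrA. Qed.
Lemma laurentDC : commutative laurentD.
Proof. by move=> f g; apply: laurentP => k /=; rewrite addrC. Qed.
Lemma laurentD0l : left_id laurent0 laurentD.
Proof. by move=> f; apply: laurentP => k /=; rewrite add0r. Qed.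
Lemma laurentDNl : left_inverse laurent0 laurentN laurentD.
Proof. by move=> f; apply: laurentP => k /=; rewrite addNr. Qed.
Lemma laurent1_neq0 : laurent1 != laurent0.
Proof.
apply/eqP => /(congr1 (fun f => coefl f 0)) /= /eqP.
by rewrite oner_eq0.
Qed.

HB.instance Definition _ :=
  GRing.isZmodule.Build laurent laurentDA laurentDC laurentD0l laurentDNl.
HB.instance Definition _ := GRing.Zmodule_isComNzRing.Build laurent
  laurentMA laurentMC laurentM1l laurentMDl laurent1_neq0.

Lemma laurent_order (f : laurent) : f != 0 ->
  exists2 v : int, f v != 0 & forall k, k < v -> f k = 0.
Proof.
move=> f0; have [a fa] := coefl_bounded f.
have ex : exists n : nat, f (a + n%:Z) != 0.
  apply: contrapT => nex; move/eqP: f0; apply.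
  apply: (@eq_laurent_from _ _ a) => // n /=; apply: contrapT => /eqP ne.
  by apply: nex; exists n.
case: (ex_minnP ex) => n fn0 minn; exists (a + n%:Z) => // k ltk.
have [/fa //|lak] := ltP k a.
have -> : k = a + `|k - a|%N%:Z by lia.
by apply/eqP; apply/negP => /negP /minn; lia.
Qed.

Fixpoint conv_inv_seq (F : nat -> K) (n : nat) : seq K :=
  if n is n'.+1 then
    let s := conv_inv_seq F n' in
    rcons s ((F 0%N)^-1 *
      ((n' == 0%N)%:R - \sum_(i < n') F i.+1 * s`_(n' - i.+1)%N))
  else [::].

Lemma conv_invP (F : nat -> K) : F 0%N != 0 ->
  exists G, forall n, conv F G n = (n == 0%N)%:R.
Proof.
move=> F0; pose s := conv_inv_seq F; exists (fun n => (s n.+1)`_n) => n.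
have sz m : size (s m) = m.
  by elim: m => //= m IH; rewrite size_rcons IH.
have st m i : (i < m)%N -> (s m)`_i = (s i.+1)`_i.
  elim: m => // m IH; rewrite ltnS leq_eqVlt => /predU1P[-> //|im].
  by rewrite /= nth_rcons -/(s _) sz im IH.
rewrite /conv big_ord_recl subn0 /= nth_rcons -/(s _) sz ltnn eqxx.
rewrite mulVKf // -[RHS](subrK (\sum_(i < n) F i.+1 * (s n)`_(n - i.+1))).
congr (_ + _); apply: eq_bigr => i _.
by rewrite st //; have := ltn_ord i; lia.
Qed.

Lemma laurent_inv_ex (f : laurent) : f != 0 -> exists g : laurent, g * f = 1.
Proof.
move=> /laurent_order [v fv0 fv].
have [|G FG] := @conv_invP (fun i => f (v + i%:Z)); first by rewrite addr0.
pose h (k : int) : K := if k < - v then 0 else G (absz (k + v)).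
have hb : forall k, k < - v -> h k = 0 by rewrite /h => k ->.
exists (@Laurent h (ex_intro _ (- v) hb)); rewrite mulrC.
apply: (@eq_laurent_from _ _ (v + - v)) => [||n].
- exact: laurentM_below.
- by rewrite subrr => k /lt_eqF /= ->.
rewrite [LHS]laurentME // subrr add0r /=.
rewrite -[RHS]FG; apply: eq_bigr => i _; rewrite /h.
by case: ltP => [|_]; [lia | congr (_ * G _); lia].
Qed.

(* Inverses are unique, so this is the inverse of any nonzero series; the
   inverse of 0 is 0. *)
Definition laurentV (f : laurent) : laurent :=
  if pselect (exists g : laurent, g * f = 1) is left ex then sval (cid ex) else 0.

Lemma laurentVl (f : laurent) : f != 0 -> laurentV f * f = 1.
Proof.
rewrite /laurentV => /laurent_inv_ex ex; case: pselect => // ex'.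
by case: cid.
Qed.

Lemma laurentV0 : laurentV 0 = 0.
Proof.
rewrite /laurentV; case: pselect => // ex; exfalso; case: ex => g /eqP.
by rewrite mulr0 eq_sym oner_eq0.
Qed.

HB.instance Definition _ :=
  GRing.ComNzRing_isField.Build laurent laurentVl laurentV0.

Definition residue (g : laurent) : K := g (-1).

Lemma expl_subproof (a : K) : bounded_below
  (fun k => if k is Posz i then a ^+ i / i`!%:R else 0).
Proof. by exists 0; case. Qed.

(* e^(ay), meaningful when K has characteristic 0. *)
Definition expl (a : K) : laurent := Laurent (expl_subproof a).

Definition binz (r : int) (s : nat) : K :=
  (\prod_(i < s) (r%:~R - i%:R)) / s`!%:R.

End LaurentType.

Arguments expl {K} a.
Arguments binz {K} r s.

(* Main.v *)
(* Put R(m, n) = Res e^(my) / (e^y - 1)^n.  Multiplying out e^y = (e^y - 1) + 1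
   gives R(m + 1, n + 1) = R(m, n) + R(m, n + 1), which is Pascal's rule for
   the right-hand side; since m ranges over Z, each n only needs one base value.
   For n = 1, 1 / (e^y - 1) = y^-1 + ... has residue 1; for n > 1,
   e^y / (e^y - 1)^n is up to a nonzero scalar the derivative of
   (e^y - 1)^(1 - n), so that R(1, n) = 0. *)
Require Import Defs.
From mathcomp Require Import all_boot all_order all_algebra.
From mathcomp Require Import classical_sets fsbigop.
From mathcomp Require Import zify ring.
Import Order.TTheory GRing.Theory Num.Theory.
Local Open Scope ring_scope.

(** Equal differences carry an equality at [a] both upward and downward, so over all integers [m]
    one base value suffices. *)
Lemma eq_of_eq_diff (V : zmodType) (F G : int -> V) (a : int) :
  F a = G a -> (forall m, F (m + 1) - F m = G (m + 1) - G m) -> F =1 G.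
Proof.
move=> Fa FG.
have up m : F m = G m -> F (m + 1) = G (m + 1).
  by move=> e; have := FG m; rewrite e => /addIr.
have down m : F (m + 1) = G (m + 1) -> F m = G m.
  by move=> e; have := FG m; rewrite e => /addrI /oppr_inj.
suff FGa k : F (a + k) = G (a + k) by move=> m; rewrite -(subrKC a m) FGa.
elim/int_rect: k => [|k IH|k IH]; first by rewrite addr0.
  by rewrite intS [1 + _]addrC addrA up.
by apply: down; rewrite (_ : _ + 1 = a - k%:Z) //; lia.
Qed.

Section Binz.
Variable K : fieldType.
Hypothesis charK0 : [pchar K] =i pred0.

Lemma natS_neq0 n : n.+1%:R != 0 :> K.
Proof. by rewrite ((pcharf0P K).1 charK0). Qed.

Lemma fact_neq0 n : n`!%:R != 0 :> K.
Proof. by rewrite ((pcharf0P K).1 charK0) -lt0n fact_gt0. Qed.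

Lemma binz0 r : binz r 0 = 1 :> K.
Proof. by rewrite /binz big_ord0 fact0 divr1. Qed.

Lemma binz0S s : binz 0 s.+1 = 0 :> K.
Proof. by rewrite /binz big_ord_recl subr0 !mul0r. Qed.

(** Pascal's rule: split off the first factor of the product at [r + 1] and the last one at [r].
    Both leave the product for [binz r s], and r + 1 = (r - s) + (s + 1). *)
Lemma binzS r s : binz (r + 1) s.+1 = binz r s.+1 + binz r s :> K.
Proof.
rewrite /binz big_ord_recl big_ord_recr /= subr0.
have -> : \prod_(i < s) ((r + 1)%:~R - (bump 0 i)%:R) =
    \prod_(i < s) (r%:~R - i%:R) :> K.
  by apply: eq_bigr => i _; rewrite /bump add1n -natr1 intrD; ring.
rewrite factS natrM intrD -natr1.
by field; rewrite natr1 natS_neq0 fact_neq0.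
Qed.

End Binz.

Section LaurentTheory.
Variable K : fieldType.
Implicit Types (f g : laurent K) (k : int).

Lemma coeflD f g k : (f + g) k = f k + g k. Proof. by []. Qed.

Lemma coeflN f k : (- f) k = - f k. Proof. by []. Qed.

Lemma coefl1 k : (1 : laurent K) k = (k == 0)%:R. Proof. by []. Qed.

Lemma coeflMn f n k : (f *+ n) k = f k *+ n.
Proof. by elim: n => // n IH; rewrite !mulrS coeflD IH. Qed.

Lemma laurentX_subproof : bounded_below (fun k => (k == 1)%:R : K).
Proof. by exists 1 => k /lt_eqF ->. Qed.

Definition laurentX : laurent K := Laurent laurentX_subproof.

Lemma coeflXM f k : (laurentX * f) k = f (k - 1).
Proof.
rewrite -[LHS]/(\sum_(i \in [set: int]) laurentX i * f (k - i)).
rewrite -(@fsbig_widen _ _ _ _ [set 1]) ?fsbig_set1 ?mul1r //.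
by move=> i [_ /eqP /negPf /= ->]; rewrite mul0r.
Qed.

Lemma euler_subproof f : bounded_below (fun k => k%:~R * f k).
Proof.
by have [a fa] := coefl_bounded f; exists a => k /fa ->; rewrite mulr0.
Qed.

(* The derivation y d/dy: it acts diagonally, so that Leibniz' rule holds
   coefficientwise without reindexing. *)
Definition euler f : laurent K := Laurent (euler_subproof f).

Lemma eulerM f g : euler (f * g) = euler f * g + f * euler g.
Proof.
have [[a fa] [b gb]] := (coefl_bounded f, coefl_bounded g).
have ef k : k < a -> euler f k = 0 by move=> /fa /= ->; rewrite mulr0.
have eg k : k < b -> euler g k = 0 by move=> /gb /= ->; rewrite mulr0.
have fg := laurentM_below fa gb.
apply: (@eq_laurent_from _ _ _ (a + b)) => [k lk|k lk|n].
- by rewrite /= [X in _ * X]fg // mulr0.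
- by rewrite coeflD [X in X + _](laurentM_below ef gb) //
    [X in _ + X](laurentM_below fa eg) // addr0.
rewrite coeflD [X in _ = X + _](laurentME ef gb).
rewrite [X in _ = _ + X](laurentME fa eg).
rewrite -[LHS]/(_ * laurentM f g _) (laurentME fa gb) mulr_sumr -big_split /=.
(* The weight of each term of the product splits as a + b + n = (a + i) + (b + (n - i)). *)
apply: eq_bigr => i _; have := ltn_ord i; rewrite ltnS => lein.
by rewrite -subzn // !intrD intrN; ring.
Qed.

Lemma euler1 : euler 1 = 0.
Proof.
apply: laurentP => k; rewrite -[LHS]/(k%:~R * (1 : laurent K) k) coefl1.
by case: eqP => [->|_]; rewrite ?mul0r ?mulr0.
Qed.

Lemma eulerX f n : euler (f ^+ n.+1) = f ^+ n * euler f *+ n.+1.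
Proof.
elim: n => [|n IH]; first by rewrite expr1 expr0 mul1r.
by rewrite exprS eulerM IH mulrnAr mulrA -exprS [euler f * _]mulrC -mulrS.
Qed.

(** Leibniz' rule applied to [f * f^-1 = 1]. *)
Lemma eulerV f : f != 0 -> euler f^-1 = - (euler f / f ^+ 2).
Proof.
move=> f0; have := eulerM f f^-1; rewrite divff // euler1 => /esym /eqP.
rewrite addrC addr_eq0 => /eqP e.
by apply: (mulfI f0); rewrite e mulrN mulrCA expr2 invfM mulVKf.
Qed.

(** This says that derivatives have residue 0: the coefficient of y^0 in y f' is that of y^-1 in
    f'. *)
Lemma euler_coef0 f : euler f 0 = 0.
Proof. by rewrite /= mul0r. Qed.

(** If [f^-1] has order [v], the coefficient of y^(1 + v) in [f * f^-1 = 1] is the product of the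
    leading coefficients. It is nonzero, which forces [v = -1]. *)
Lemma residue_inv f : f 1 = 1 -> (forall k, k < 1 -> f k = 0) ->
  residue f^-1 = 1.
Proof.
move=> f1 f_lt1; have f0 : f != 0.
  by apply/eqP => e; have /eqP := oner_neq0 K; rewrite -f1 e.
have [v gv0 gv] := laurent_order (invr_neq0 f0).
have /(congr1 (fun h : laurent K => h (1 + v))) := divff f0.
rewrite -[1 + v]addr0 -[X in X = _ -> _]/(laurentM _ _ (1 + v + 0%:Z)).
rewrite (laurentME f_lt1 gv) /conv big_ord1 subnn !addr0 f1 mul1r coefl1 => e.
have /eqP v1 : 1 + v == 0.
  by move: gv0; rewrite e; case: (1 + v == 0); rewrite ?eqxx.
by rewrite /residue (_ : -1 = v) ?e ?v1 //; lia.
Qed.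

Lemma residue_expl (a : K) : residue (expl a) = 0.
Proof. by []. Qed.

Lemma expl0 : expl 0 = 1 :> laurent K.
Proof.
apply: laurentP => -[[|n]|n] //=; first by rewrite expr0 divr1.
by rewrite expr0n mul0r.
Qed.

Hypothesis charK0 : [pchar K] =i pred0.

Lemma explD (a b : K) : expl (a + b) = expl a * expl b.
Proof.
have e0 (c : K) k : k < 0 -> expl c k = 0 by case: k.
apply: (@eq_laurent_from _ _ _ (0 + 0)) => [||n].
- exact: e0.
- exact: laurentM_below (e0 a) (e0 b).
rewrite [RHS](laurentME (e0 a) (e0 b)) addr0 add0r /= [a + b]addrC.
rewrite exprDn mulr_suml.
apply: eq_bigr => i _; have := ltn_ord i; rewrite ltnS => lein.
(* Factoring n! as C(n, i) i! (n - i)! cancels the binomial coefficient from the expansion of the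
   power. *)
rewrite -(bin_fact lein) !natrM -mulr_natr.
have bin0 : 'C(n, i)%:R != 0 :> K.
  by rewrite ((pcharf0P K).1 charK0) -lt0n bin_gt0.
by field; rewrite bin0 !fact_neq0.
Qed.

Lemma euler_expl1 : euler (expl 1) = laurentX * expl 1.
Proof.
apply: laurentP => k; rewrite coeflXM.
case: k => [[|n]|n]; rewrite /= ?mul0r ?mulr0 //.
rewrite subn1 /= !expr1n !div1r factS natrM invfM -pmulrn mulVKf //.
exact: natS_neq0.
Qed.

Let w : laurent K := expl 1 - 1.

Lemma expl1B1_lt1 k : k < 1 -> w k = 0.
Proof.
rewrite /w coeflD coeflN coefl1; case: k => [[|n]|n] //= _.
  by rewrite expr0 divr1 subrr.
by rewrite subr0.
Qed.

Lemma expl1B1_1 : w 1 = 1.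
Proof. by rewrite /w coeflD coeflN coefl1 /= expr1 divr1 subr0. Qed.

Lemma expl1B1_neq0 : w != 0.
Proof. by apply/eqP => e; have /eqP := oner_neq0 K; rewrite -expl1B1_1 e. Qed.

Lemma residue_expl1_div n : residue (expl 1 / w ^+ n.+2) = 0.
Proof.
have : euler (w^-1 ^+ n.+1) 0 = 0 by exact: euler_coef0.
(* The coefficient of y^0 on the right is -(n + 1) times the wanted residue, and n + 1 is invertible
   in characteristic 0. *)
have -> : euler (w^-1 ^+ n.+1) = - (laurentX * (expl 1 / w ^+ n.+2)) *+ n.+1.
  rewrite eulerX eulerV ?expl1B1_neq0 //.
  have -> : euler w = laurentX * expl 1.
    rewrite -euler_expl1; apply: laurentP => k.
    rewrite -[LHS]/(k%:~R * (expl 1 k - (1 : laurent K) k)) coefl1 /=.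
    by case: (k =P 0) => [->|_]; rewrite ?mul0r ?subr0.
  congr (_ *+ _); rewrite mulrN mulrC -!mulrA exprVn -invfM -exprD.
  by rewrite add2n.
rewrite coeflMn coeflN coeflXM -mulr_natr => /eqP.
by rewrite mulf_eq0 (negPf (natS_neq0 _ charK0 n)) orbF oppr_eq0 => /eqP.
Qed.

Lemma residue_succ (m : int) n :
  residue (expl (m + 1)%:~R / w ^+ n.+1) =
  residue (expl m%:~R / w ^+ n.+1) + residue (expl m%:~R / w ^+ n).
Proof.
rewrite -[RHS]/(residue (_ + _)) intrD explD.
have -> : expl 1 = w + 1 by rewrite subrK.
congr (residue _); rewrite mulrDr mulr1 mulrDl addrC; congr (_ + _).
by rewrite -mulrA exprS invfM mulVKf ?expl1B1_neq0.
Qed.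

Lemma residue_expl_div_expX n (m : int) :
  residue (expl m%:~R / w ^+ n.+1) = binz (m - 1) n.
Proof.
elim: n m => [|n IH].
  (* Base value at m = 0, the residue of [w^-1]. The differences are residues of [expl m%:~R], a
     power series, hence 0. *)
  apply: (@eq_of_eq_diff _ _ _ 0) => [|m].
    rewrite expl0 mul1r expr1 binz0.
    by apply: residue_inv expl1B1_1 expl1B1_lt1.
  by rewrite residue_succ expr0 divr1 residue_expl !binz0 addr0 !subrr.
(* At m = 1 both sides vanish; the differences agree by the induction hypothesis and Pascal's
   rule. *)
apply: (@eq_of_eq_diff _ _ _ 1) => [|m].
  by rewrite residue_expl1_div subrr binz0S.
rewrite residue_succ IH (addrAC m 1) binzS //.
by rewrite ![_ + _ - _]addrAC !subrr !add0r.
Qed.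

End LaurentTheory.

Theorem lemma4p1 (K : fieldType) (charK0 : [pchar K] =i pred0)
    (m : int) (n : nat) (n_gt0 : (0 < n)%N) :
  residue (expl m%:~R / (expl 1 - 1) ^+ n) = binz (m - 1) (n - 1)%N :> K.
Proof.
by case: n n_gt0 => // n _; rewrite subn1 residue_expl_div_expX.
Qed.
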